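(* The space $(\mathsf{PDgm}^0,d_\bullet)$ of birth-zero persistence diagrams, equipped with the distance $d_\bullet=d_B=d_E=d_L$ (these coincide on $\mathsf{PDgm}^0$), does not admit a coarse embedding into a Hilbert space. Consequently, the full spaces of persistence diagrams $(\mathsf{PDgm},d_\bullet)$, with $d_\bullet=d_B$ or $d_\bullet=d_E=d_L$, also do not admit a coarse embedding into a Hilbert space.
   Context: Let $\mathbb{R}^2_<=\{(b,d)\in\mathbb{R}^2: b<d\}$. A persistence diagram is a finite multiset $Y=\{(b_i,d_i)\}_{i=1}^N$ of points of $\mathbb{R}^2_<$; $\mathsf{PDgm}$ is the set of all of them. $\mathsf{PDgm}^0\subset\mathsf{PDgm}$ is the set of birth-zero persistence diagrams, i.e. those of the form $\{(0,d_i)\}_{i=1}^N$ with $d_1\ge\dots\ge d_N>0$. For $b\le d$, $\mathrm{rank}[Y](b,d)$ is the number (with multiplicity) of $(b_i,d_i)\in Y$ with $b_i\le b\le d<d_i$. The erosion distance $d_E(Y,Y')$ is the infimum of all $\varepsilon\ge0$ such that, for all $b\le d$, $\mathrm{rank}[Y](b-\varepsilon,d+\varepsilon)\le\mathrm{rank}[Y'](b,d)$ and $\mathrm{rank}[Y'](b-\varepsilon,d+\varepsilon)\le\mathrm{rank}[Y](b,d)$. The landscape distance is $d_L(Y,Y')=\sup_{k\in\mathbb{N},t\in\mathbb{R}}|\lambda^Y_k(t)-\lambda^{Y'}_k(t)|$, where $\lambda^Y_k(t)=\sup\{h\ge0:\mathrm{rank}[Y](t-h,t+h)\ge k\}$ (supremum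 of the empty set being $0$; $\mathbb{N}=\{1,2,\dots\}$). The bottleneck distance is $$d_B(Y,Y')=\min_{\phi:S\to S'}\max\left\{\max_{(b,d)\in S}d_\infty((b,d),\phi(b,d)),\ \max_{(b,d)\in Y\setminus S}\tfrac{d-b}{2},\ \max_{(b',d')\in Y'\setminus S'}\tfrac{d'-b'}{2}\right\},$$ the minimum being over bijections $\phi$ between sub-multisets $S\subseteq Y$ and $S'\subseteq Y'$, with $d_\infty((b,d),(b',d'))=\max\{|b-b'|,|d-d'|\}$ and maxima over empty sets equal to $0$. A map $f:(X,d_X)\to(Z,d_Z)$ of metric spaces is a coarse embedding if there are non-decreasing $\rho^-,\rho^+:[0,\infty)\to[0,\infty)$ with $\lim_{t\to\infty}\rho^-(t)=\infty$ and $\rho^-(d_X(x,x'))\le d_Z(f(x),f(x'))\le\rho^+(d_X(x,x'))$ for all $x,x'\in X$. *)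

(* Defs.v *)
From HB Require Import structures.
From mathcomp Require Import all_boot all_order all_algebra.
From mathcomp Require Import finmap multiset.
From mathcomp Require Import complex.
From mathcomp Require Import all_classical all_reals all_analysis.

Set Implicit Arguments.
Unset Strict Implicit.
Unset Printing Implicit Defensive.

Import Order.TTheory GRing.Theory Num.Theory.
Import numFieldNormedType.Exports.

Local Open Scope classical_set_scope.
Local Open Scope ring_scope.

Section PersistenceDiagrams.
Variable R : realType.

Definition point := {p : R * R | p.1 < p.2}.

Definition birth (p : point) : R := (val p).1.
Definition death (p : point) : R := (val p).2.

Definition PDgm := {mset point}%mset.

Identity Coercion mset_of_PDgm : PDgm >-> multiset_of.

(* The condition death p > 0 is implied by birth p < death p. *)
Definition birth_zero (Y : PDgm) : bool := all (fun p => birth p == 0) Y.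

Definition PDgm0 := {Y : PDgm | birth_zero Y}.

Coercion diagram (Y : PDgm0) : PDgm := val Y.

(* A multiset coerces to a sequence listing its elements with multiplicity. *)
Definition rank (Y : PDgm) (b d : R) : nat :=
  count (fun p => [&& birth p <= b, b <= d & d < death p]) Y.

Definition dE (Y Y' : PDgm) : R :=
  inf [set e : R | 0 <= e /\
    forall b d : R, b <= d ->
      (rank Y (b - e) (d + e) <= rank Y' b d)%N /\
      (rank Y' (b - e) (d + e) <= rank Y b d)%N].

(* The library's sup of the empty set is 0.  For k >= 1 the set below is
   bounded above, since rank Y b d vanishes once d - b is large. *)
Definition landscape (Y : PDgm) (k : nat) (t : R) : R :=
  sup [set h : R | 0 <= h /\ (k <= rank Y (t - h) (t + h))%N].

Definition dL (Y Y' : PDgm) : R :=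
  sup [set x : R | exists (k : nat) (t : R),
    (1 <= k)%N /\ x = `|landscape Y k t - landscape Y' k t|].

Definition dinfty (p q : point) : R :=
  Num.max `|birth p - birth q| `|death p - death q|.

Definition half_persistence (p : point) : R := (death p - birth p) / 2.

Section Bottleneck.
Variables Y Y' : PDgm.

(* Elements with multiplicity are addressed by their position in the
   enumeration of the multiset, so that sub-multisets are sets of positions. *)
Definition elt (X : PDgm) (i : 'I_(size X)) : point := tnth (in_tuple X) i.

(* A bijection between sub-multisets S of Y and S' of Y' is given by its graph
   M; then S and S' are the two projections of M. *)
Definition is_matching (M : {set 'I_(size Y) * 'I_(size Y')}) : bool :=
  [forall e in M, forall e' in M, (e.1 == e'.1) == (e.2 == e'.2)].

Definition matching_cost (M : {set 'I_(size Y) * 'I_(size Y')}) : R :=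
  Num.max (\big[Num.max/0]_(e in M) dinfty (elt e.1) (elt e.2))
    (Num.max
      (\big[Num.max/0]_(i | i \notin [set e.1 | e in M]%SET)
         half_persistence (elt i))
      (\big[Num.max/0]_(j | j \notin [set e.2 | e in M]%SET)
         half_persistence (elt j))).

(* The empty matching is a matching, so its cost is a harmless default. *)
Definition dB : R :=
  \big[Num.min/matching_cost finset.set0]_(M | is_matching M) matching_cost M.

End Bottleneck.

End PersistenceDiagrams.

Section CoarseEmbeddings.
Variable R : realType.

Definition coarse_embedding (X Z : Type) (dX : X -> X -> R) (dZ : Z -> Z -> R)
    (f : X -> Z) : Prop :=
  exists rhom rhop : R -> R,
    [/\ (forall t, 0 <= t -> 0 <= rhom t) /\ (forall t, 0 <= t -> 0 <= rhop t),
        (forall s t, 0 <= s -> s <= t -> rhom s <= rhom t) /\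
        (forall s t, 0 <= s -> s <= t -> rhop s <= rhop t),
        rhom t @[t --> +oo] --> +oo &
        forall x x' : X,
          rhom (dX x x') <= dZ (f x) (f x') /\ dZ (f x) (f x') <= rhop (dX x x')].

(* A Hilbert space is a complete normed space whose norm comes from an inner
   product. *)
Definition is_hilbert (K : numFieldType) (conj : K -> K)
    (H : completeNormedModType K) : Prop :=
  exists dot : {dot H for conj}, forall x : H, dot x x = `|x| ^+ 2.

(* Real and complex Hilbert spaces are both considered; in the complex case the
   norm takes values in R[i], and its real part is the norm in R. *)
Definition embeds_coarsely_in_hilbert (X : Type) (dX : X -> X -> R) : Prop :=
  (exists H : completeNormedModType R, is_hilbert idfun H /\
     exists f : X -> H, coarse_embedding dX (fun u v => `|u - v|) f) \/
  (exists H : completeNormedModType R[i], is_hilbert Num.conj H /\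
     exists f : X -> H, coarse_embedding dX (fun u v => complex.Re `|u - v|) f).

End CoarseEmbeddings.

(* Main.v *)
Require Import Defs.
From mathcomp Require Import all_boot all_order all_algebra.
From mathcomp Require Import finmap multiset.
From mathcomp Require Import complex.
From mathcomp Require Import all_classical all_reals all_analysis.
From mathcomp Require Import zify ring lra.

(** The three distances are compared through their defining inequalities. An
erosion by [e] amounts to a bound by [e] on the differences of the landscape
functions, as one sees on intervals written as [[t - h, t + h]]
([dE_eq_dL]). The cost of a matching is always an admissible erosion
([erodes_matching_cost]). For birth-zero diagrams the converse holds: sort the
bars by decreasing length; an erosion by [e] forces bars at equal positions to
differ by at most [e], unless both have length at most [2 * e], so matching
equal positions costs at most [e] ([dB_le_erodes]).

For the absence of coarse embeddings, the point is that birth-zero diagrams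
contain large cubes with the maximum metric. Adding a vector with entries in
[[0, L]] to a staircase of steps [L] gives a diagram whose bars are always
sorted in the same way, and the distance of two such diagrams is the maximum
norm of the difference of the vectors ([dE_ladder_le], [le_dE_ladder]).
Discrete tori of any dimension and size embed isometrically into such cubes.

A map [f] from a torus to a Hilbert space obeys the following obstruction, in
the spirit of Enflo. Given two families of points, the sum of the squared
distances within the families is at most twice the sum of the squared
distances across ([negative_type]). Split the coordinates at random into two
parts and take as families the translates of a point by the vectors with
entries [a] and [- a] on one part, respectively on the other, and zero
elsewhere. Differences across are vectors with entries [a] and [- a] on
all coordinates; differences within have entries [a *+ 2] and [- a *+ 2] on a
random set containing each coordinate with probability one quarter. Hence
the mean squared displacement by [f] does not grow when the step doubles and
the support is thinned accordingly ([spread_double]). After [k] doublings each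
coordinate survives with probability [4^-k]; in dimension [4^k] the support is
nonempty with probability at least one half ([spread_lower],
[expr_one_sub_inv_le]). Thus pairs at distance [2^k] would have images at a
distance bounded by a constant times the bound for pairs at distance one,
whatever [k], and the lower control function could not tend to infinity
([no_coarse_embedding]). The full spaces of diagrams contain the birth-zero
ones, and inherit the obstruction. *)

Set Implicit Arguments.
Unset Strict Implicit.
Unset Printing Implicit Defensive.

Import Order.TTheory GRing.Theory Num.Theory.
Import numFieldNormedType.Exports.

Local Open Scope classical_set_scope.
Local Open Scope ring_scope.

(** * Erosion, landscape and bottleneck distances *)

Lemma leq_card_rel (I J : finType) (A : {set I}) (B : {set J}) (r : I -> J -> bool) :
    (forall a, a \in A -> exists2 b, b \in B & r a b) ->
    (forall a a' b, r a b -> r a' b -> a = a') ->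
  (#|A| <= #|B|)%N.
Proof.
move=> tot inj; pose g a := [pick b in B | r a b].
have gP a : a \in A -> exists b, [/\ g a = Some b, b \in B & r a b].
  move=> aA; rewrite /g; case: pickP => [b /andP[bB rab]|none]; first by exists b.
  by have [b bB rab] := tot a aA; have := none b; rewrite bB rab.
rewrite -(card_in_imset (f := g) (D := A)); last first.
  move=> a a' /gP[b [-> _ rab]] /gP[b' [-> _ rab']] [bb'].
  by apply: inj rab _; rewrite bb'.
apply: leq_trans (leq_imset_card Some B); apply/subset_leq_card/fintype.subsetP.
by move=> _ /imsetP[a aA ->]; have [b [-> bB _]] := gP a aA; rewrite imset_f.
Qed.

Section Distances.
Variable R : realType.
Implicit Types (Y : PDgm R) (b d e h t : R) (k : nat).

Definition erodes Y Y' e : Prop :=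
  0 <= e /\ forall b d, b <= d ->
    (rank Y (b - e) (d + e) <= rank Y' b d)%N /\
    (rank Y' (b - e) (d + e) <= rank Y b d)%N.

Lemma erodes_sym Y Y' e : erodes Y Y' e -> erodes Y' Y e.
Proof.
by case=> e0 H; split => // b d bd; case: (H b d bd).
Qed.

Definition rank_set Y b d : {set 'I_(size Y)} :=
  [set i | [&& birth (elt i) <= b, b <= d & d < death (elt i)]]%SET.

Lemma rankE Y b d : rank Y b d = #|rank_set Y b d|.
Proof.
rewrite /rank -sum1_count big_tnth -sum1_card.
by apply: eq_bigl => i; rewrite inE.
Qed.

(** A point counted by [rank Y (b - c) (d + c)] has half-persistence greater than
the cost [c], hence is matched, and its partner has moved by at most [c] in
each coordinate, hence is counted by [rank Y' b d]. *)
Lemma erodes_matching_cost Y Y' (M : {set 'I_(size Y) * 'I_(size Y')}) :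
  is_matching M -> erodes Y Y' (matching_cost M).
Proof.
move=> /forall_inP Mm.
set c := matching_cost M.
have injM u v : u \in M -> v \in M -> (u.1 == v.1) = (u.2 == v.2).
  by move=> uM vM; have /forall_inP/(_ v vM)/eqP := Mm u uM.
have := lexx c; rewrite {1}/c /matching_cost !ge_max.
move=> /andP[/bigmax_leP[c0 cM] /andP[/bigmax_leP[_ cL] /bigmax_leP[_ cR]]].
split => // b d bd; rewrite !rankE; split.
- apply: (@leq_card_rel _ _ _ _ (fun i j => (i, j) \in M)) => [i|i i' j ijM i'jM].
    rewrite inE => /and3P[ib _ id].
    have /imsetP[[i' j] /= ijM ii'] : i \in [set e.1 | e in M]%SET.
      apply: contraLR (id) => /cL; rewrite /half_persistence -leNgt => ?; lra.
    subst i'; exists j => //; have := cM _ ijM; rewrite /dinfty /= ge_max.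
    move=> /andP[]; rewrite !ler_distl inE => /andP[h1 h2] /andP[h3 h4].
    by apply/and3P; split => //; lra.
  by have /= := injM _ _ ijM i'jM; rewrite eqxx => /eqP.
- apply: (@leq_card_rel _ _ _ _ (fun j i => (i, j) \in M)) => [j|j j' i ijM ij'M].
    rewrite inE => /and3P[ib _ id].
    have /imsetP[[i j'] /= ijM jj'] : j \in [set e.2 | e in M]%SET.
      apply: contraLR (id) => /cR; rewrite /half_persistence -leNgt => ?; lra.
    subst j'; exists i => //; have := cM _ ijM; rewrite /dinfty /= ge_max.
    move=> /andP[]; rewrite !ler_distl inE => /andP[h1 h2] /andP[h3 h4].
    by apply/and3P; split => //; lra.
  by have /= := injM _ _ ijM ij'M; rewrite eqxx => /esym/eqP.
Qed.

(** The empty matching provides a witness, so that the infimum defining [dE] is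
taken over a nonempty set. *)
Lemma exists_erodes Y Y' : exists e, erodes Y Y' e.
Proof.
exists (matching_cost (finset.set0 : {set 'I_(size Y) * 'I_(size Y')})).
by apply: erodes_matching_cost; apply/forall_inP => e; rewrite inE.
Qed.

Lemma dE_le Y Y' e : erodes Y Y' e -> dE Y Y' <= e.
Proof.
by move=> h; apply: ge_inf => //; exists 0 => x [].
Qed.

Lemma le_dE Y Y' e : (forall e', erodes Y Y' e' -> e <= e') -> e <= dE Y Y'.
Proof. by move=> h; apply: lb_le_inf => //; exact: exists_erodes. Qed.

Lemma dE_ge0 Y Y' : 0 <= dE Y Y'.
Proof. by apply: le_dE => e []. Qed.

Lemma dE_le_dB Y Y' : dE Y Y' <= dB Y Y'.
Proof.
apply: le_bigmin => [|M Mm]; apply: dE_le; apply: erodes_matching_cost => //.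
by apply/forall_inP => e; rewrite inE.
Qed.

Lemma rank_antimono Y b d b' d' : b' <= b -> b <= d -> d <= d' ->
  (rank Y b' d' <= rank Y b d)%N.
Proof.
move=> bb bd dd; apply: sub_count => p /and3P[h1 h2 h3].
by apply/and3P; split => //; [exact: le_trans bb|exact: le_lt_trans h3].
Qed.

Definition landscape_set Y k t :=
  [set h : R | 0 <= h /\ (k <= rank Y (t - h) (t + h))%N].

(** An [e] for which [Y] is eroded by the empty diagram bounds the half-width of
every interval of positive rank. *)
Lemma landscape_set_ubound Y k t : (1 <= k)%N -> has_ubound (landscape_set Y k t).
Proof.
move=> k1; have [e [e0 he]] := exists_erodes Y (mset0 : PDgm R).
exists e => h [h0 kh]; rewrite leNgt; apply/negP => eh.
have [|+ _] := he (t - (h - e)) (t + (h - e)); first by lra.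
rewrite (_ : t - (h - e) - e = t - h); last by ring.
rewrite (_ : t + (h - e) + e = t + h); last by ring.
move=> /(leq_trans kh)/(leq_trans k1); rewrite /rank.
rewrite (_ : (mset0 : PDgm R) = [::] :> seq _) //; apply/eqP.
by rewrite -size_eq0 size_mset0.
Qed.

Lemma le_landscape Y k t h :
  (1 <= k)%N -> 0 <= h -> (k <= rank Y (t - h) (t + h))%N ->
  h <= landscape Y k t.
Proof. by move=> k1 h0 hk; apply: (ub_le_sup (landscape_set_ubound Y t k1)). Qed.

Lemma landscape_ge0 Y k t : (1 <= k)%N -> 0 <= landscape Y k t.
Proof.
move=> k1; have [[h [h0 hk]]|no] := pselect (landscape_set Y k t !=set0).
  exact: le_trans h0 (le_landscape k1 h0 hk).
by rewrite /landscape sup_out// => -[/no].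
Qed.

(** The supremum need not be attained, because bars are open at their death; only
the levels strictly below it are certain to carry rank [k]. *)
Lemma lt_landscape Y k t h : 0 <= h -> h < landscape Y k t ->
  (k <= rank Y (t - h) (t + h))%N.
Proof.
move=> h0 hl; have ne : landscape_set Y k t !=set0.
  apply: contrapT => no; move: hl; rewrite /landscape sup_out ?ltNge ?h0 //.
  by case=> /no.
have [h' [h'0 kh'] hh'] := sup_gt ne hl.
by apply: leq_trans kh' _; apply: rank_antimono; lra.
Qed.

Lemma landscape_le_erodes Y Y' e k t : (1 <= k)%N -> erodes Y Y' e ->
  landscape Y k t <= landscape Y' k t + e.
Proof.
move=> k1 [e0 he]; rewrite leNgt; apply/negP => hl.
have h0 := landscape_ge0 Y' t k1.
pose h := (landscape Y k t + (landscape Y' k t + e)) / 2.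
have kh : (k <= rank Y (t - h) (t + h))%N by apply: lt_landscape; rewrite /h; lra.
have : h - e <= landscape Y' k t.
  apply: le_landscape => //; first by rewrite /h; lra.
  apply: leq_trans kh _.
  have [|+ _] := he (t - (h - e)) (t + (h - e)); first by rewrite /h; lra.
  rewrite (_ : t - (h - e) - e = t - h); last by ring.
  by rewrite (_ : t + (h - e) + e = t + h); last by ring.
by rewrite /h; lra.
Qed.

(** The two distances encode the same inequalities. The interval [[b, d]] is
[[t - h, t + h]] for its midpoint [t], and enlarging it by [e] replaces [h] by
[h + e]; thus an erosion by [e] bounds the variation of the landscape functions
by [e]. The suprema in the landscapes need not be attained, so the converse is
applied to the numbers [e] above [dL]. *)
Lemma dE_eq_dL Y Y' : dE Y Y' = dL Y Y'.
Proof.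
pose D := [set x : R | exists k t,
    (1 <= k)%N /\ x = `|landscape Y k t - landscape Y' k t|].
have ubD e : erodes Y Y' e -> ubound D e.
  move=> he _ [k [t [k1 ->]]]; rewrite ler_distl.
  have := landscape_le_erodes t k1 he.
  by have := landscape_le_erodes t k1 (erodes_sym he); lra.
have neD : D !=set0 by exists `|landscape Y 1 0 - landscape Y' 1 0|; exists 1%N, 0.
apply/eqP; rewrite eq_le; apply/andP; split; last first.
  by apply: le_dE => e /ubD; exact: ge_sup.
have dL_ub k t : (1 <= k)%N -> `|landscape Y k t - landscape Y' k t| <= dL Y Y'.
  move=> k1; apply: (@ub_le_sup _ D); last by exists k, t.
  by have [e /ubD] := exists_erodes Y Y'; exists e.
have dL0 : 0 <= dL Y Y' by apply: le_trans (dL_ub 1%N 0 isT).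
have main Z Z' e : dL Y Y' < e ->
    (forall k t, (1 <= k)%N -> `|landscape Z k t - landscape Z' k t| <= dL Y Y') ->
    forall b d, b <= d -> (rank Z (b - e) (d + e) <= rank Z' b d)%N.
  move=> de hZ b d bd; have [->//|] := posnP (rank Z (b - e) (d + e)).
  set k := rank Z _ _ => k1.
  pose t := (b + d) / 2; pose h := (d - b) / 2.
  have bE : b = t - h by rewrite /t /h; field.
  have dE' : d = t + h by rewrite /t /h; field.
  have h0 : 0 <= h by rewrite /h; lra.
  rewrite bE dE'; apply: lt_landscape => //.
  have : h + e <= landscape Z k t.
    apply: le_landscape => //; first lra.
    by rewrite /k bE dE' !opprD !addrA.
  by have := hZ k t k1; rewrite ler_distl; lra.
rewrite leNgt; apply/negP => lt.
pose e := (dL Y Y' + dE Y Y') / 2.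
have de : dL Y Y' < e by rewrite /e; lra.
have : dE Y Y' <= e.
  apply: dE_le; split=> [|b d bd]; first lra.
  split; first by apply: main => //.
  by apply: main => // k t k1; rewrite distrC dL_ub.
by rewrite /e; lra.
Qed.
End Distances.

(** * The bottleneck distance of birth-zero diagrams *)

Section BirthZero.
Variable R : realType.
Implicit Types (Y : PDgm R) (b d e : R).

Lemma birth_zero_elt Y (i : 'I_(size Y)) : birth_zero Y -> birth (elt i) = 0.
Proof. by move=> /allP/(_ _ (mem_tnth i (in_tuple Y)))/eqP. Qed.

(** Bars by decreasing death, ties being broken by their index to obtain a strict
total order; [position] is then the place of a bar in the sorted diagram. *)
Definition outranks Y (i' i : 'I_(size Y)) : bool :=
  (death (elt i) < death (elt i')) ||
  ((death (elt i) == death (elt i')) && (i' < i)%N).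

Definition position Y (i : 'I_(size Y)) : nat := #|[set i' | outranks i' i]%SET|.

Lemma outranks_irr Y (i : 'I_(size Y)) : outranks i i = false.
Proof. by rewrite /outranks !ltxx ltnn andbF. Qed.

Lemma outranks_trans Y (j i k : 'I_(size Y)) :
  outranks i j -> outranks j k -> outranks i k.
Proof.
rewrite /outranks => /orP[ij|/andP[/eqP ij ji]] /orP[jk|/andP[/eqP jk kj]].
- by rewrite (lt_trans jk ij).
- by rewrite jk ij.
- by rewrite -ij jk.
- by rewrite jk ij eqxx (ltn_trans ji kj) orbT.
Qed.

Lemma outranks_total Y (i j : 'I_(size Y)) :
  i != j -> outranks i j || outranks j i.
Proof.
rewrite /outranks; case: ltgtP => //= _ ij.
by rewrite orbC -neq_ltn val_eqE eq_sym.
Qed.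

Lemma outranks_position Y (i j : 'I_(size Y)) :
  outranks i j -> (position i < position j)%N.
Proof.
move=> ij; apply: proper_card; apply/properP; split.
  by apply/fintype.subsetP => k; rewrite !inE => /outranks_trans; apply.
by exists i; rewrite !inE ?outranks_irr.
Qed.

Lemma position_inj Y : injective (@position Y).
Proof.
move=> i j ij; apply/eqP; apply: contraT => /outranks_total/orP[] /outranks_position;
by rewrite ij ltnn.
Qed.

Lemma position_lt Y (i : 'I_(size Y)) : (position i < size Y)%N.
Proof.
rewrite -[X in (_ < X)%N]card_ord -cardsT; apply: proper_card; apply/properP.
by split; [exact: finset.subsetT | exists i; rewrite !inE ?outranks_irr].
Qed.

Lemma position_surj Y p : (p < size Y)%N -> exists i : 'I_(size Y), position i = p.
Proof.
move=> pY; pose g (i : 'I_(size Y)) := Ordinal (position_lt i).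
have gI : injective g by move=> i j /(congr1 val)/= /position_inj.
have [h _ hg] := injF_bij gI.
by exists (h (Ordinal pY)); have /(congr1 val) := hg (Ordinal pY).
Qed.

(** The bars alive at [d] form an initial segment of the sorted diagram. This
turns inequalities between ranks into inequalities between the deaths of bars
at equal positions. *)
Lemma position_lt_rank Y b d (i : 'I_(size Y)) : birth_zero Y -> 0 <= b -> b <= d ->
  (position i < rank Y b d)%N = (d < death (elt i)).
Proof.
move=> Y0 b0 bd; rewrite rankE.
have mem j : (j \in rank_set Y b d) = (d < death (elt j)).
  by rewrite inE birth_zero_elt// b0 bd.
apply/idP/idP => [|di].
  apply: contraLR; rewrite -leNgt -leqNgt => di; apply: subset_leq_card.
  apply/fintype.subsetP => j; rewrite mem inE /outranks => dj.
  by rewrite (le_lt_trans di dj).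
apply: proper_card; apply/properP; split.
  apply/fintype.subsetP => j; rewrite mem inE /outranks.
  by case/orP => [|/andP[/eqP <- //]]; exact: lt_trans.
by exists i; rewrite ?mem // inE outranks_irr.
Qed.

Lemma rank_le_size Y b d : (rank Y b d <= size Y)%N.
Proof. exact: count_size. Qed.

(** The erosion inequalities with [b < e] are void, as no bar is born before [0],
and those with [e <= b] reduce to [b = e]. Read at the position of [i], these say
that the bar of [Y'] there is shorter than bar [i] by at most [e], provided
that bar [i] survives beyond [2 * e]; the inequalities from [Y'] to [Y] bound
it from above. *)
Lemma exists_partner Y Y' e (i : 'I_(size Y)) :
    birth_zero Y -> birth_zero Y' -> erodes Y Y' e -> 2 * e < death (elt i) ->
  exists j : 'I_(size Y'), position j = position i /\
    `|death (elt i) - death (elt j)| <= e.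
Proof.
move=> Y0 Y0' [e0 he] ei.
have key x : e <= x -> x + e < death (elt i) -> (position i < rank Y' e x)%N.
  move=> ex xi; have [+ _] := he e x ex; apply: leq_trans.
  by rewrite subrr position_lt_rank //; lra.
have [j pj] : exists j : 'I_(size Y'), position j = position i.
  apply: position_surj; apply: leq_trans (rank_le_size Y' e e).
  by apply: key; lra.
exists j; split=> //.
have keyj x : e <= x -> x + e < death (elt i) -> x < death (elt j).
  by move=> ex xi; rewrite -(position_lt_rank j Y0' e0 ex) pj key.
rewrite ler_distl; apply/andP; split; last first.
  rewrite leNgt; apply/negP => lt.
  (* a time at or after [e], strictly between the death of [j] and [death i - e] *)
  have := keyj ((Num.max e (death (elt j)) + (death (elt i) - e)) / 2).
  by case: (leP e (death (elt j))) => ? /(_ _ _); lra.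
rewrite leNgt; apply/negP => lt.
have ei' : e <= death (elt i) by lra.
have [_] := he e (death (elt i)) ei'.
rewrite subrr leqNgt => /negP; apply.
have : (position i < rank Y' 0 (death (elt i) + e))%N.
  by rewrite -pj position_lt_rank //; lra.
apply: leq_trans; rewrite ltnS leqNgt position_lt_rank //; last lra.
Qed.

(** Bars at equal positions are matched whenever this costs at most [e]; the bars
left over have length at most [2 * e] by [exists_partner]. *)
Lemma dB_le_erodes Y Y' e : birth_zero Y -> birth_zero Y' -> erodes Y Y' e ->
  dB Y Y' <= e.
Proof.
move=> Y0 Y0' he; have e0 : 0 <= e by case: he.
pose M := [set u : 'I_(size Y) * 'I_(size Y') |
  (position u.1 == position u.2) && (`|death (elt u.1) - death (elt u.2)| <= e)]%SET.
have Mm : is_matching M.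
  apply/forall_inP => -[i j]; rewrite inE /= => /andP[/eqP ij _].
  apply/forall_inP => -[i' j']; rewrite inE /= => /andP[/eqP ij' _].
  apply/eqP; apply/eqP/eqP => [ii|jj].
    by apply: position_inj; rewrite -ij -ij' ii.
  by apply: position_inj; rewrite ij ij' jj.
apply: le_trans (bigmin_le_cond _ _ Mm) _.
rewrite /matching_cost !ge_max; apply/and3P; split; apply/bigmax_leP; split=> //.
- move=> [i j]; rewrite inE /= => /andP[_ ij].
  by rewrite /dinfty !birth_zero_elt// subrr normr0 ge_max e0.
- move=> i; apply: contraR; rewrite /half_persistence birth_zero_elt// -ltNge => ei.
  have [|j [pj ij]] := exists_partner (i := i) Y0 Y0' he; first lra.
  by apply/imsetP; exists (i, j); rewrite // inE /= pj eqxx.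
- move=> j; apply: contraR; rewrite /half_persistence birth_zero_elt// -ltNge => ej.
  have [|i [pi ij]] := exists_partner (i := j) Y0' Y0 (erodes_sym he); first lra.
  by apply/imsetP; exists (i, j); rewrite // inE /= pi eqxx distrC.
Qed.

Lemma dB_eq_dE Y Y' : birth_zero Y -> birth_zero Y' -> dB Y Y' = dE Y Y'.
Proof.
move=> Y0 Y0'; apply/eqP; rewrite eq_le dE_le_dB andbT.
by apply: le_dE => e; exact: dB_le_erodes.
Qed.
End BirthZero.

(** * Negative type and doubling on the torus *)

(** The average of [r ^+ #|W :&: S|] over a uniformly random set [S]. The
elements of [W] are retained independently with probability one half, and each
contributes the factor [r] or [1]. *)
Lemma sum_expr_cardI (R : realFieldType) (I : finType) (W : {set I}) (r : R) :
  \sum_(S : {set I}) r ^+ #|W :&: S| = #|{set I}|%:R * ((1 + r) / 2) ^+ #|W|.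
Proof.
transitivity (\prod_i (if i \in W then r + 1 else 1 + 1) : R).
  rewrite (eq_bigr (fun i => (if i \in W then r else 1) + 1)); last first.
    by move=> i _; case: ifP.
  rewrite bigA_distr; apply: eq_bigr => S _.
  rewrite -prodr_const [LHS]big_mkcond /=; apply: eq_bigr => i _.
  by rewrite inE; case: (i \in W); case: (i \in S).
have -> : #|{set I}| = (2 ^ #|I|)%N.
  by rewrite -[X in (2 ^ X)%N]cardsT -card_powerset powersetT cardsT.
rewrite natrX -prodr_const.
rewrite -[in RHS]prodr_const [X in _ * X]big_mkcond -big_split /=.
apply: eq_bigr => i _; case: ifP => _; [by field|ring].
Qed.

Section NegativeType.
(* [B] stands for a real inner product or for the real part of a complex one. *)
Variables (R : realFieldType) (H : zmodType) (B : H -> H -> R).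
Hypothesis BBl : forall u v w, B (u - v) w = B u w - B v w.
Hypothesis BBr : forall u v w, B w (u - v) = B w u - B w v.
Hypothesis B_ge0 : forall u, 0 <= B u u.

Lemma form_suml (A : finType) (x : A -> H) w :
  B (\sum_i x i) w = \sum_i B (x i) w.
Proof.
have B0 : B 0 w = 0 by rewrite -(subrr 0) BBl subrr.
have BN u : B (- u) w = - B u w by rewrite -sub0r BBl B0 sub0r.
apply: (big_morph (B^~ w)) => // u v.
by rewrite -[v in LHS]opprK BBl BN opprK.
Qed.

Lemma form_sumr (A : finType) (x : A -> H) w :
  B w (\sum_i x i) = \sum_i B w (x i).
Proof.
have B0 : B w 0 = 0 by rewrite -(subrr 0) BBr subrr.
have BN u : B w (- u) = - B w u by rewrite -sub0r BBr B0 sub0r.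
apply: (big_morph (B w)) => // u v.
by rewrite -[v in LHS]opprK BBr BN opprK.
Qed.

Lemma sum_form_sub (A : finType) (x y : A -> H) :
  \sum_i \sum_j B (x i - y j) (x i - y j) =
  #|A|%:R * (\sum_i B (x i) (x i) + \sum_i B (y i) (y i)) -
  B (\sum_i x i) (\sum_j y j) - B (\sum_j y j) (\sum_i x i).
Proof.
rewrite form_suml [B (\sum_j y j) _]form_suml.
under [\sum_i B (x i) (\sum_j y j)]eq_bigr => i _ do rewrite form_sumr.
under [\sum_i B (y i) (\sum_j x j)]eq_bigr => i _ do rewrite form_sumr.
rewrite [\sum_i \sum_j B (y i) (x j)]exchange_big /=.
transitivity (\sum_i \sum_j
  (B (x i) (x i) + B (y j) (y j) - B (x i) (y j) - B (y j) (x i))).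
  by apply: eq_bigr => i _; apply: eq_bigr => j _; rewrite BBl !BBr; ring.
under [LHS]eq_bigr => i _ do rewrite !big_split /= !sumrN sumr_const.
rewrite !big_split /= !sumrN sumr_const sumrMnl.
by rewrite mulr_natl mulrnDl.
Qed.

(** The difference of the two sides is twice the square norm of
[\sum_i x i - \sum_j y j]: this is the parallelogram law for several points. *)
Lemma negative_type (A : finType) (x y : A -> H) :
  \sum_i \sum_j B (x i - x j) (x i - x j) +
  \sum_i \sum_j B (y i - y j) (y i - y j) <=
  2 * \sum_i \sum_j B (x i - y j) (x i - y j).
Proof.
rewrite !sum_form_sub.
have := B_ge0 (\sum_i x i - \sum_j y j); rewrite BBl !BBr; lra.
Qed.

Section Torus.
Variables (I : finType) (A : finZmodType) (f : {ffun I -> A} -> H).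
Implicit Types (a : A) (W S T E : {set I}) (g x : {ffun I -> A}).

(** Up to normalization, the mean over the torus of the squared distance between
the images under [f] of a point and of its translate by [g]. Averaging over the torus makes it a function of the difference of two
translations, to which the negative type inequality applies. *)
Definition displacement g : R :=
  \sum_(x : {ffun I -> A}) B (f (x + g) - f x) (f (x + g) - f x).

Lemma displacement_ge0 g : 0 <= displacement g.
Proof. by apply: sumr_ge0. Qed.

Lemma displacementB g h : displacement (g - h) =
  \sum_(x : {ffun I -> A}) B (f (x + g) - f (x + h)) (f (x + g) - f (x + h)).
Proof.
rewrite /displacement (reindex_inj (addIr h)) /=.
by apply: eq_bigr => x _; rewrite -addrA (addrC h) subrK.
Qed.

Lemma displacement_negative_type (D : finType) (u v : D -> {ffun I -> A}) :
  \sum_i \sum_j displacement (u i - u j) +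
  \sum_i \sum_j displacement (v i - v j) <=
  2 * \sum_i \sum_j displacement (u i - v j).
Proof.
have swap (p q : D -> {ffun I -> A}) :
    \sum_i \sum_j displacement (p i - q j) =
    \sum_(x : {ffun I -> A}) \sum_i \sum_j
      B (f (x + p i) - f (x + q j)) (f (x + p i) - f (x + q j)).
  rewrite [RHS]exchange_big; apply: eq_bigr => i _ /=.
  by rewrite [RHS]exchange_big; apply: eq_bigr => j _ /=; rewrite displacementB.
by rewrite !swap -big_split mulr_sumr; apply: ler_sum => x _; exact: negative_type.
Qed.

Definition signed a W E : {ffun I -> A} :=
  [ffun i => if i \in W then if i \in E then a else - a else 0].

Definition spread a W : R := \sum_E displacement (signed a W E).

Lemma spread_ge0 a W : 0 <= spread a W.
Proof. by apply: sumr_ge0 => E _; exact: displacement_ge0. Qed.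

(** The difference of two independent sign vectors on [W :&: S] vanishes where they
agree and has entries [a *+ 2] or [- a *+ 2] with random signs where they
differ, which happens on a uniformly random set. *)
Lemma sum_spread_double a W S :
  \sum_E \sum_E' displacement (signed a (W :&: S) E - signed a (W :&: S) E') =
  \sum_T spread (a *+ 2) (W :&: S :&: T).
Proof.
rewrite [RHS]exchange_big; apply: eq_bigr => E _ /=.
pose symdiff T : {set I} := [set i | (i \in E) (+) (i \in T)]%SET.
have symdiffI : injective symdiff.
  by apply: (can_inj (g := symdiff)) => T; apply/setP => i; rewrite !inE addKb.
rewrite (reindex_inj symdiffI) /=.
apply: eq_bigr => T _; congr displacement; apply/ffunP => i.
rewrite !ffunE !inE; case: (i \in W) => //=; last by rewrite subrr.
case: (i \in S) => //=; last by rewrite subrr.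
case: (i \in E); case: (i \in T) => //=; rewrite ?subrr ?opprK ?mulr2n //.
by rewrite opprD.
Qed.

(** Sign vectors on the two complementary parts of [W] differ by a sign vector on
all of [W]. *)
Lemma sum_spread_cross a W S :
  \sum_E \sum_E' displacement (signed a (W :&: S) E - signed a (W :&: ~: S) E') =
  #|{set I}|%:R * spread a W.
Proof.
have -> : #|{set I}|%:R * spread a W =
    \sum_E \sum_(E' : {set I}) displacement (signed a W E).
  by under [RHS]eq_bigr do rewrite sumr_const; rewrite sumrMnl mulr_natl.
(* complementing the second sign set absorbs the sign of the difference *)
under eq_bigr => E _ do rewrite (reindex_inj (can_inj (@finset.setCK I))).
rewrite [LHS]pair_bigA [RHS]pair_bigA /=.
pose splice E T : {set I} := [set i | if i \in S then i \in E else i \in T]%SET.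
(* exchanging two sign sets outside [S] is an involution on pairs *)
pose h (u : {set I} * {set I}) := (splice u.1 u.2, splice u.2 u.1).
have hK : involutive h.
  by move=> [E E']; rewrite /h /=; congr pair;
     apply/setP => i; rewrite !inE; case: (i \in S).
rewrite [RHS](reindex_inj (inv_inj hK)) /=; apply: eq_bigr => -[E E'] _ /=.
congr displacement; apply/ffunP => i; rewrite !ffunE !inE.
case: (i \in W) => //=; last by rewrite subr0.
case: (i \in S) => //=; first by rewrite subr0.
by rewrite sub0r; case: (i \in E'); rewrite ?opprK.
Qed.

(** Doubling the step while thinning the support does not increase the average
displacement. For a random [S], the sign vectors supported on [W :&: S] and
those supported on [W :\: S] are the two families in the negative type
inequality; the differences within a family have step [a *+ 2] and support
[W :&: S :&: T], the differences across have step [a] and support [W]. *)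
Lemma spread_double a W :
  \sum_S \sum_T spread (a *+ 2) (W :&: S :&: T) <= #|{set I}|%:R ^+ 2 * spread a W.
Proof.
pose F S := \sum_T spread (a *+ 2) (W :&: S :&: T).
have FS S : F S + F (~: S)%SET <= 2 * (#|{set I}|%:R * spread a W).
  rewrite /F -!sum_spread_double -(sum_spread_cross a W S).
  exact: displacement_negative_type.
have : \sum_S (F S + F (~: S)%SET) <=
    \sum_(S : {set I}) 2 * (#|{set I}|%:R * spread a W).
  by apply: ler_sum => S _.
have FC : \sum_S F (~: S)%SET = \sum_S F S.
  by rewrite [RHS](reindex_inj (can_inj (@finset.setCK I))).
rewrite big_split /= FC sumr_const.
rewrite -[in leRHS]mulr_natl /F; lra.
Qed.

(** Under [k] applications of [spread_double] each element of [W] survives with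
probability [(4 ^+ k)^-1], independently, so that some element survives with
probability [1 - (1 - (4 ^+ k)^-1) ^+ #|W|]; whenever this occurs the
displacement at step [a *+ 2 ^ k] is at least [c]. *)
Lemma spread_lower a W k (c : R) : 0 <= c ->
    (forall V E, V != finset.set0 -> c <= displacement (signed (a *+ 2 ^ k) V E)) ->
  c * #|{set I}|%:R * (1 - (1 - (4 ^+ k)^-1) ^+ #|W|) <= spread a W.
Proof.
move=> c0; elim: k a W => [|k IH] a W hc.
  rewrite expr0 invr1 subrr expr0n.
  have [|W0] := eqVneq W finset.set0.
    by move=> ->; rewrite cards0 subrr mulr0 spread_ge0.
  rewrite cards_eq0 (negPf W0) subr0 mulr1 mulr_natr -sumr_const.
  by apply: ler_sum => E _; have := hc W E W0; rewrite expn0 mulr1n.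
set M : R := #|{set I}|%:R.
have M0 : 0 < M by rewrite ltr0n; apply/card_gt0P; exists finset.set0.
rewrite -(ler_pM2l (exprn_gt0 2 M0)); apply: le_trans (spread_double a W).
pose l : R := 1 - (4 ^+ k)^-1.
apply: le_trans (_ : \sum_S \sum_T c * M * (1 - l ^+ #|W :&: S :&: T|) <= _); last first.
  apply: ler_sum => S _; apply: ler_sum => T _; apply: IH => V E V0.
  by rewrite -mulrnA -expnS; exact: hc.
have MS : \sum_(S : {set I}) 1 = M by rewrite sumr_const.
under eq_bigr => S _ do rewrite -mulr_sumr sumrB MS sum_expr_cardI -/M.
rewrite -mulr_sumr sumrB -mulr_sumr sum_expr_cardI -/M.
rewrite (_ : \sum_(S : {set I}) M = M * M); last by rewrite sumr_const mulr_natl.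
rewrite (_ : (1 + (1 + l) / 2) / 2 = 1 - (4 ^+ k.+1)^-1); last first.
  by rewrite /l exprS invfM; field; rewrite expf_eq0 pnatr_eq0 andbF.
by rewrite le_eqVlt; apply/orP; left; apply/eqP; ring.
Qed.
End Torus.
End NegativeType.

(** * Cubes of birth-zero diagrams *)

Section Ladder.
Variable R : realType.

(** The bar from [0] to [h]; the default bar from [0] to [1] makes it total, while
keeping the birth at zero. *)
Definition bar (h : R) : Defs.point R :=
  insubd (exist _ (0, 1) ltr01 : Defs.point R) (0, h).

Lemma birth_bar h : birth (bar h) = 0.
Proof. by rewrite /birth /bar val_insubd /=; case: ifP. Qed.

Lemma death_bar h : 0 < h -> death (bar h) = h.
Proof. by move=> h0; rewrite /death /bar val_insubd /= h0. Qed.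

Variables (J : finType) (L : R).
Hypothesis L0 : 0 < L.
Implicit Types x y : J -> R.

(** The term in [L] stacks the bars in layers of thickness [L], one for each index,
so that vectors with entries in [[0, L]] are sorted in the same way. Diagrams
with equally sorted bars are compared entry by entry. *)
Definition height x (j : J) : R := (enum_rank j).+1%:R * L + x j.

Definition ladder_mset x : PDgm R := seq_mset [seq bar (height x j) | j <- enum J].

Lemma ladder_birth_zero x : birth_zero (ladder_mset x).
Proof.
rewrite /birth_zero (perm_all _ (perm_eq_seq_mset _)).
by apply/allP => _ /mapP[j _ ->]; rewrite birth_bar.
Qed.

Definition ladder x : PDgm0 R := exist _ (ladder_mset x) (ladder_birth_zero x).

Lemma height_gt0 x j : 0 <= x j -> 0 < height x j.
Proof. by move=> xj; rewrite /height ltr_pwDl// mulr_gt0// ltr0n. Qed.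

Lemma rank_ladder x b d : (forall j, 0 <= x j) ->
  rank (ladder x) b d = #|[set j | [&& 0 <= b, b <= d & d < height x j]]%SET|.
Proof.
move=> x0; rewrite /rank (permP (perm_eq_seq_mset _)) count_map.
rewrite -sum1_count big_enum_cond -sum1_card; apply: eq_bigl => j /=.
by rewrite !inE birth_bar death_bar// height_gt0.
Qed.

Lemma dE_ladder_le x y s : (forall j, 0 <= x j) -> (forall j, 0 <= y j) -> 0 <= s ->
  (forall j, `|x j - y j| <= s) -> dE (ladder x) (ladder y) <= s.
Proof.
move=> x0 y0 s0 xy; apply: dE_le; split=> // b d bd.
rewrite !rank_ladder//.
by split; apply: subset_leq_card; apply/fintype.subsetP => j;
  rewrite !inE => /and3P[? _];
  have := xy j; rewrite ler_distl /height => ? ?; apply/and3P; split => //; lra.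
Qed.

(** At time [height y j] the diagram of [y] has only the bars above layer [j]
alive, whereas that of [x] would still have bar [j] as well after a delay
[e < x j - y j], contradicting the erosion. The offset of one layer in
[height] ensures [e <= height y j], as needed to erode from [e] down to birth
[0]. *)
Lemma erodes_ladder x y e j :
  (forall j, 0 <= x j <= L) -> (forall j, 0 <= y j <= L) ->
  erodes (ladder x) (ladder y) e -> x j - y j <= e.
Proof.
move=> xL yL [e0 he]; rewrite leNgt; apply/negP => lt.
have x0 i : 0 <= x i by case/andP: (xL i).
have y0 i : 0 <= y i by case/andP: (yL i).
have hj : 0 <= (enum_rank j)%:R * L by rewrite mulr_ge0 // ltW.
have ed : e <= height y j.
  by have := y0 j; have /andP[_] := xL j; rewrite /height -natr1 mulrDl mul1r; lra.
have [+ _] := he e (height y j) ed; rewrite !rank_ladder// leqNgt => /negP; apply.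
apply: proper_card; apply/properP; split.
  apply/fintype.subsetP => i; rewrite !inE subrr lexx /= => /and3P[_ _].
  have [ij|ji|/ord_inj/enum_rank_inj ->] := ltngtP (enum_rank i) (enum_rank j).
  - have : (enum_rank i).+1%:R * L <= (enum_rank j)%:R * L
      by rewrite ler_pM2r// ler_nat.
    have /andP[_] := yL i; have := y0 j.
    by rewrite /height -[(enum_rank j).+1%:R]natr1 mulrDl mul1r; lra.
  - move=> _; have : (enum_rank j).+1%:R * L <= (enum_rank i)%:R * L
      by rewrite ler_pM2r// ler_nat.
    have := x0 i; have := y0 j; have /andP[_] := xL j => h1 h2 h3.
    rewrite /height -[(enum_rank i).+1%:R]natr1 mulrDl mul1r => h4; apply/andP; split; lra.
  - by rewrite ltxx.
exists j; rewrite !inE ?ltxx ?andbF // subrr lexx /=.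
by have := height_gt0 (y0 j); rewrite /height => hy; apply/andP; split; lra.
Qed.

Lemma le_dE_ladder x y j :
  (forall j, 0 <= x j <= L) -> (forall j, 0 <= y j <= L) ->
  `|x j - y j| <= dE (ladder x) (ladder y).
Proof.
move=> xL yL; apply: le_dE => e he; rewrite ler_distl.
have := erodes_ladder j xL yL he.
by have := erodes_ladder j yL xL (erodes_sym he); lra.
Qed.
End Ladder.

(** * Embedding tori *)

Section Cycle.
Variable k : nat.
Let N := (2 ^ k.+1)%N.
(** The distance from [u] to [0] in the cycle with [2 ^ k.+1] vertices. *)
Definition cycle_norm (u : 'Z_N) : nat := minn u (N - u).

Lemma NE : N = (2 * 2 ^ k)%N.
Proof. exact: expnS. Qed.

Lemma N_gt1 : (1 < N)%N.
Proof. by have := NE; have := expn_gt0 2 k; lia. Qed.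

Lemma val_lt_N (u : 'Z_N) : (u < N)%N.
Proof. by have := ltn_ord u; rewrite [X in (_ < X)%N]Zp_cast // N_gt1. Qed.

Lemma cycle_norm0 : cycle_norm 0 = 0.
Proof. by rewrite /cycle_norm min0n. Qed.

Lemma cycle_norm_le u : (cycle_norm u <= 2 ^ k)%N.
Proof. by have := NE; rewrite /cycle_norm; lia. Qed.

Lemma cycle_norm_antipode : cycle_norm (1 *+ 2 ^ k) = (2 ^ k)%N.
Proof.
by rewrite /cycle_norm val_Zp_nat ?N_gt1// modn_small NE; have := expn_gt0 2 k; lia.
Qed.

(** The two sign choices of a step to the antipode coincide. *)
Lemma opp_antipode : - (1 *+ 2 ^ k) = 1 *+ 2 ^ k :> 'Z_N.
Proof.
apply/eqP; rewrite eq_sym -addr_eq0 -mulrnDr addnn -mul2n -expnS.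
by rewrite -[X in X == _]/(N%:R) pchar_Zp ?N_gt1.
Qed.

Lemma cycle_norm_succ (u : 'Z_N) :
  (cycle_norm (u + 1)%R <= (cycle_norm u).+1)%N &&
  (cycle_norm u <= (cycle_norm (u + 1)%R).+1)%N.
Proof.
have uN := val_lt_N u.
have -> : cycle_norm (u + 1) = (minn ((u + 1) %% N) (N - (u + 1) %% N))%N.
  have -> : u + 1 = (u + 1)%N%:R :> 'Z_N by rewrite natrD natr_Zp.
  by rewrite /cycle_norm val_Zp_nat ?N_gt1.
have [lt|ge] := ltnP (u + 1) N.
  by rewrite modn_small // /cycle_norm; lia.
have -> : (u + 1)%N = N by lia.
rewrite modnn /cycle_norm; lia.
Qed.
End Cycle.

Lemma bernoulli_le (R : realFieldType) (x : R) n :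
  0 <= x -> 1 + n%:R * x <= (1 + x) ^+ n.
Proof.
move=> x0; elim: n => [|n IH]; first by rewrite mul0r addr0 expr0.
have n0 : 0 <= n%:R :> R by rewrite ler0n.
rewrite exprS -natr1; nra.
Qed.

(** [(1 - n^-1)^n * (1 + n^-1)^n <= 1], and the second factor is at least [2]. *)
Lemma expr_one_sub_inv_le (R : realFieldType) n : (0 < n)%N ->
  (1 - n%:R^-1) ^+ n <= 2^-1 :> R.
Proof.
move=> n0; have nR : 0 < n%:R :> R by rewrite ltr0n.
have i0 : 0 < n%:R^-1 :> R by rewrite invr_gt0.
have i1 : n%:R^-1 <= 1 :> R by rewrite invf_le1 // ler1n.
have := bernoulli_le n (ltW i0); rewrite divff ?gt_eqF// => B2.
have a0 : 0 <= (1 - n%:R^-1) ^+ n :> R by rewrite exprn_ge0 // subr_ge0.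
have : (1 - n%:R^-1) ^+ n * (1 + n%:R^-1) ^+ n <= 1 :> R.
  rewrite -exprMn exprn_ile1 //; nra.
nra.
Qed.

(** * Non-embeddability *)

Section NoEmbedding.
Variables (R : realType) (H : zmodType) (B : H -> H -> R) (nrm : H -> R).
Hypothesis BBl : forall u v w, B (u - v) w = B u w - B v w.
Hypothesis BBr : forall u v w, B w (u - v) = B w u - B w v.
Hypothesis nrm_ge0 : forall u, 0 <= nrm u.
Hypothesis B_nrm : forall u, B u u = nrm u ^+ 2.

(** The torus of dimension [4 ^ k] over the cycle of length [2 ^ k.+1], with the
maximum metric, embeds isometrically into the birth-zero diagrams: the vertex
[g] goes to the ladder of its distances, coordinate by coordinate, to all
vertices of the cycle. Sign vectors move points by at most [1], nonzero
antipodal vectors by [2 ^ k], and in this dimension the probability in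
[spread_lower] is at least one half. *)
Lemma no_coarse_embedding (f : PDgm0 R -> H) :
  ~ coarse_embedding (fun Y Y' : PDgm0 R => dE Y Y') (fun u v => nrm (u - v)) f.
Proof.
move=> [rhom [rhop [[rhom0 rhop0] [rhom_le rhop_le] /cvgryPge rhom_oo hf]]].
have [M [_ hM]] := rhom_oo (2 * rhop 1 + 1).
have [k kM] : exists k : nat, M < 2 ^+ k.
  exists (Num.bound `|M|); apply: le_lt_trans (ler_norm M) _.
  apply: lt_trans (archi_boundP (normr_ge0 M)) _.
  by rewrite -natrX ltr_nat ltn_expl.
have hk : 2 * rhop 1 + 1 <= rhom (2 ^+ k) by exact: hM.
pose N := (2 ^ k.+1)%N; pose I := 'I_(4 ^ k).
have B_ge0 u : 0 <= B u u by rewrite B_nrm exprn_ge0.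
pose G := {ffun I -> 'Z_N}.
pose x (g : G) (p : I * 'Z_N) : R := (cycle_norm (g p.1 - p.2))%:R.
have xL g p : 0 <= x g p <= 2 ^+ k.
  by rewrite /x ler0n -natrX ler_nat cycle_norm_le.
have x0 g p : 0 <= x g p by case/andP: (xL g p).
have L0 : 0 < 2 ^+ k :> R by rewrite exprn_gt0.
pose F (g : G) : PDgm0 R := ladder (2 ^+ k) (x g).
have near W E g : dE (F (g + signed 1 W E)) (F g) <= 1.
  apply: dE_ladder_le => // -[i z]; rewrite /x /= !ffunE.
  have S u : `|(cycle_norm (u + 1 : 'Z_N))%:R - (cycle_norm u)%:R| <= 1 :> R.
    have /andP[] := cycle_norm_succ u; rewrite -!(ler_nat R) -!natr1 ler_distl => ? ?.
    by apply/andP; split; lra.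
  case: (i \in W); last by rewrite addr0 subrr normr0.
  case: (i \in E); first by rewrite addrAC.
  by rewrite addrAC distrC; have := S (g i - z - 1); rewrite subrK.
(* the coordinate measuring the distance to [g i] itself goes from [0] to [2 ^ k] *)
have far V E g : V != finset.set0 ->
    2 ^+ k <= dE (F (g + signed (1 *+ 2 ^ k) V E)) (F g).
  move=> /set0Pn[i iV].
  apply: le_trans (le_dE_ladder L0 (i, g i) (xL _) (xL _)).
  rewrite /x /= !ffunE iV opp_antipode if_same addrAC subrr add0r.
  by rewrite cycle_norm_antipode cycle_norm0 subr0 natrX ger0_norm // ltW.
pose fF := f \o F.
pose D := displacement B fF; pose n : R := #|{: G}|%:R.
have upper W E : D (signed 1 W E) <= n * rhop 1 ^+ 2.
  rewrite /D /displacement /n mulr_natl -sumr_const; apply: ler_sum => g _.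
  rewrite B_nrm ler_pXn2r ?nnegrE //; last exact: rhop0.
  have [_] := hf (F (g + signed 1 W E)) (F g); move/le_trans; apply.
  by apply: rhop_le => //; exact: dE_ge0.
have lower V E : V != finset.set0 ->
    n * rhom (2 ^+ k) ^+ 2 <= D (signed (1 *+ 2 ^ k) V E).
  move=> V0; rewrite /D /displacement /n mulr_natl -sumr_const; apply: ler_sum => g _.
  rewrite B_nrm ler_pXn2r ?nnegrE //; last by apply: rhom0; exact: ltW.
  have [+ _] := hf (F (g + signed (1 *+ 2 ^ k) V E)) (F g); apply: le_trans.
  by apply: rhom_le; [exact: ltW|exact: far].
have n0 : 0 < n by rewrite ltr0n; apply/card_gt0P; exists 0.
have c0 : 0 <= n * rhom (2 ^+ k) ^+ 2 by rewrite mulr_ge0 ?sqr_ge0 ?ltW.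
have := spread_lower BBl BBr B_ge0 (f := fF) finset.setT c0 lower.
rewrite cardsT card_ord.
have -> : (4 ^+ k)^-1 = ((4 ^ k)%N%:R)^-1 :> R by rewrite natrX.
have half : (1 - (4 ^ k)%N%:R^-1) ^+ (4 ^ k) <= 2^-1 :> R.
  by apply: expr_one_sub_inv_le; rewrite expn_gt0.
pose m : R := #|{set I}|%:R.
have m0 : 0 < m by rewrite ltr0n; apply/card_gt0P; exists finset.set0.
have : spread B fF 1 finset.setT <= m * (n * rhop 1 ^+ 2).
  rewrite /spread /m mulr_natl -sumr_const; apply: ler_sum => E _; exact: upper.
rewrite -/m => up low; have := le_trans low up.
rewrite [_ * m]mulrC -!mulrA ler_pM2l // ler_pM2l //.
have := rhop0 1 ler01; nra.
Qed.
End NoEmbedding.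

Section Hilbert.
Variable R : realType.

Lemma dE_not_in_hilbert :
  ~ embeds_coarsely_in_hilbert (fun Y Y' : PDgm0 R => dE Y Y').
Proof.
case=> -[H [[dot dotE] [f hf]]].
- apply: (@no_coarse_embedding R H (fun u v => dot u v) (fun u => `|u|) _ _ _ _ f hf).
  + by move=> u v w; rewrite linearBl.
  + by move=> u v w; rewrite linearBr.
  + by move=> u; exact: normr_ge0.
  + exact: dotE.
- apply: (@no_coarse_embedding R H (fun u v => complex.Re (dot u v))
    (fun u => complex.Re `|u|) _ _ _ _ f hf).
  + by move=> u v w; rewrite linearBl raddfB.
  + by move=> u v w; rewrite linearBr raddfB.
  + by move=> u; have := normr_ge0 u; rewrite lecE => /andP[].
  + move=> u; rewrite dotE.
    have /ger0_Im := normr_ge0 u; case: `|u| => a b /= ->.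
    by rewrite !expr2 /=; ring.
Qed.

Lemma embeds_coarsely_in_hilbert_comp (X X' : Type) (dX : X -> X -> R) (g : X' -> X) :
  embeds_coarsely_in_hilbert dX ->
  embeds_coarsely_in_hilbert (fun x y => dX (g x) (g y)).
Proof.
case=> -[H [hH [f [rhom [rhop [h1 h2 h3 h4]]]]]]; [left|right];
  by exists H; split => //; exists (f \o g), rhom, rhop; split => // x x'; exact: h4.
Qed.
End Hilbert.

Theorem theorem4p21 (R : realType) :
  [/\ (forall Y Y' : PDgm0 R, dB Y Y' = dE Y Y' /\ dE Y Y' = dL Y Y'),
      (forall d : PDgm R -> PDgm R -> R,
         [\/ d = @dB R, d = @dE R | d = @dL R] ->
         ~ embeds_coarsely_in_hilbert (fun Y Y' : PDgm0 R => d Y Y')),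
      (forall Y Y' : PDgm R, dE Y Y' = dL Y Y') &
      (forall d : PDgm R -> PDgm R -> R,
         [\/ d = @dB R, d = @dE R | d = @dL R] ->
         ~ embeds_coarsely_in_hilbert d)].
Proof.
have dB0 (Y Y' : PDgm0 R) : dB Y Y' = dE Y Y' by apply: dB_eq_dE; exact: valP.
have no0 (d : PDgm R -> PDgm R -> R) : [\/ d = @dB R, d = @dE R | d = @dL R] ->
    ~ embeds_coarsely_in_hilbert (fun Y Y' : PDgm0 R => d Y Y').
  move=> hd; suff -> : (fun Y Y' : PDgm0 R => d Y Y') =
      (fun Y Y' : PDgm0 R => dE Y Y').
    exact: dE_not_in_hilbert.
  by apply/funext => Y; apply/funext => Y'; case: hd => -> //; rewrite dE_eq_dL.
split=> // [Y Y'|Y Y'|d hd emb]; first by split; [|exact: dE_eq_dL].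
  exact: dE_eq_dL.
exact: no0 hd (embeds_coarsely_in_hilbert_comp (@diagram R) emb).
Qed.
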